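(* Let $P=(G,v_s,V_g)$ where $G=(V,E,c,\Theta)$ is an estimated weighted digraph, $v_s\in V$ and $V_g\subset V$, and let $u_{prune}$ be any value. If BEAST (described in the context) run on $P$ with threshold $u_{prune}$ returns $(\emptyset,\infty)$, then no solution $\pi$ for $P$ with $u_{\Theta(\pi)}\le u_{prune}$ exists. Conversely, if BEAST returns a solution, then it is correct, i.e. it is a path $\pi$ from $v_s$ to a node of $V_g$ with $u_{\Theta(\pi)}=U^*$, returned together with $U^*$.
   Context: EWDG: $G=(V,E,c,\Theta)$, with $c:E\to\mathbb{R}^+$ unobservable and $\Theta$ mapping each edge $e$ to a finite non-empty sequence of estimators $\theta_e^1,\dots,\theta_e^{k(e)}$ (each of finite running time), where $\theta_e^i$ returns $(l_e^i,u_e^i)$ with $0\le l_e^i\le c(e)\le u_e^i<\infty$ and $[l_e^j,u_e^j]\subseteq[l_e^i,u_e^i]$ for $i<j$. Tightest bounds: $u_{\Theta(e)}:=u_e^{k(e)}$, and $u_{\Theta(\pi)}:=\sum_{e\in\pi}u_{\Theta(e)}$ for a path $\pi$. A solution is a path from $v_s$ to a node in $V_g$; $U^*:=\min\{u_{\Theta(\pi)}:\pi\text{ a solution}\}$. Algorithm BEAST (input $P$, parameter $u_{prune}$): set $g_u(v_s)=0$, OPEN $=\{v_s\}$ (key $g_u$), CLOSED $=\emptyset$. While OPEN is non-empty: pop $n$ from OPEN with minimal $g_u(n)$; if $n\in V_g$, return the path obtained by following parent pointers from $n$ back to $v_s$, together with $g_u(n)$. Otherwise insert $n$ into CLOSED,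 and for each successor $s$ of $n$ (edge $e=(n,s)$): if $s\notin$ OPEN $\cup$ CLOSED set $g_u(s)=\infty$; set $l(e)=0,u(e)=0$; while $g_u(n)+l(e)<g_u(s)$ and $g_u(n)+l(e)\le u_{prune}$ and estimators remain for $e$, apply the next estimator of $e$ (starting from $\theta_e^1$) and set $(l(e),u(e))$ to its output; then let $\tilde g=g_u(n)+u(e)$; if $\tilde g<g_u(s)$ and $\tilde g\le u_{prune}$, set $g_u(s)=\tilde g$, remove $s$ from OPEN if present, and insert $s$ into OPEN with key $g_u(s)$ and parent $n$. If OPEN becomes empty, return $(\emptyset,\infty)$. *)

(* Defs.v *)
From HB Require Import structures.
From mathcomp Require Import all_boot all_order all_algebra.
From mathcomp Require Import reals constructive_ereal.

Set Implicit Arguments.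
Unset Strict Implicit.
Unset Printing Implicit Defensive.

Import Order.TTheory GRing.Theory Num.Theory.

Local Open Scope ring_scope.

(* The estimators of an edge are given, in order, by the pairs (l, u) that they
   return.  cost and theta are total functions whose values outside the edge
   relation are irrelevant: all the axioms are restricted to edges.  The node
   set need not be finite, and zero-cost edges are allowed. *)
Record ewdg (R : realType) := Ewdg {
  node : eqType;
  edge : rel node;
  cost : node -> node -> R;
  theta : node -> node -> seq (R * R);
  cost_ge0 : forall v w, edge v w -> 0 <= cost v w;
  theta_neq0 : forall v w, edge v w -> theta v w != [::];
  theta_bounds : forall v w, edge v w -> forall b, b \in theta v w ->
    [/\ 0 <= b.1, b.1 <= cost v w & cost v w <= b.2];
  theta_nested : forall v w, edge v w ->
    forall i j, (i < j < size (theta v w))%N ->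
    let bi := nth (0, 0) (theta v w) i in
    let bj := nth (0, 0) (theta v w) j in
    {subset `[bj.1, bj.2] <= `[bi.1, bi.2]}
}.

Record problem (R : realType) := Problem {
  graph :> ewdg R;
  start : node graph;
  goals : pred (node graph)
}.

Section Paths.
Variables (R : realType) (G : ewdg R).

Definition u_edge (v w : node G) : R := (last (0, 0) (theta v w)).2.

(* As in path.v, the path v, p_1, ..., p_k is given by its source v and the
   sequence p of its other nodes; zip (v :: p) p lists its edges. *)
Definition u_path (v : node G) (p : seq (node G)) : R :=
  \sum_(e <- zip (v :: p) p) u_edge e.1 e.2.

End Paths.

Section Solutions.
Variables (R : realType) (P : problem R).

Definition solution (p : seq (node P)) : Prop :=
  path (@edge R P) (start P) p /\ goals (last (start P) p).

Definition u_sol (p : seq (node P)) : R := u_path (start P) p.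

(* U is the minimum U^* of u_sol over all solutions; in particular, it is
   attained. *)
Definition is_Ustar (U : R) : Prop :=
  (exists2 p, solution p & u_sol p = U) /\
  (forall p, solution p -> U <= u_sol p).

End Solutions.

Arguments solution {R} P p.
Arguments u_sol {R} P p.

Section Beast.
Variables (R : realType) (P : problem R) (u_prune : \bar R).

Local Notation V := (node P).
Local Open Scope ereal_scope.

Record state := State {
  gu : V -> \bar R;
  opn : seq V;
  closed : seq V;
  parent : V -> option V
}.

(* gu is never read at a node before it has been set there: relax resets it to
   +oo at the nodes that are in neither list. *)
Definition init : state :=
  State (fun v => if v == start P then 0 else +oo) [:: start P] [::]
    (fun=> None).

(* b is the current pair (l(e), u(e)), ths the remaining estimators of e. *)
Fixpoint refine (gn gs : \bar R) (b : R * R) (ths : seq (R * R)) : R * R :=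
  if ths is b' :: ths' then
    if (gn + b.1%:E < gs) && (gn + b.1%:E <= u_prune)
    then refine gn gs b' ths' else b
  else b.

Definition relax (n : V) (st : state) (s : V) : state :=
  let gs := if s \in opn st ++ closed st then gu st s else +oo in
  let b := refine (gu st n) gs (0, 0)%R (theta n s) in
  let gt := gu st n + b.2%:E in
  if (gt < gs) && (gt <= u_prune)
  then State [eta gu st with s |-> gt] (s :: rem s (opn st)) (closed st)
         [eta parent st with s |-> Some n]
  else State [eta gu st with s |-> gs] (opn st) (closed st) (parent st).

Definition expand (n : V) (ss : seq V) (st : state) : state :=
  foldl (relax n)
    (State (gu st) (rem n (opn st)) (n :: closed st) (parent st)) ss.

(* traceback st n p: the parent pointers lead from n back to the start node,
   and start P :: p is the node sequence obtained, in forward order. *)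
Inductive traceback (st : state) : V -> seq V -> Prop :=
| TraceStart : traceback st (start P) [::]
| TraceParent n m p : n != start P -> parent st n = Some m ->
    traceback st m p -> traceback st n (rcons p n).

Definition min_open (st : state) (n : V) : Prop :=
  n \in opn st /\ {in opn st, forall m, gu st n <= gu st m}.

(* run st out: some terminating execution of the main loop from st returns out.
   The output (emptyset, infinity) is (None, +oo), which is thus distinct from
   that of the trivial path (Some [::], 0).  Ties in OPEN are broken
   arbitrarily, and the successors of a node are visited in any order; as this
   must be a finite enumeration, expanding a node with infinitely many
   successors does not terminate. *)
Inductive run : state -> option (seq V) * \bar R -> Prop :=
| RunEmpty st : opn st = [::] -> run st (None, +oo)
| RunGoal st n p : min_open st n -> goals n -> traceback st n p ->
    run st (Some p, gu st n)
| RunExpand st n ss out : min_open st n -> ~~ goals n ->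
    uniq ss -> (forall s, (s \in ss) = edge n s) ->
    run (expand n ss st) out -> run st out.

Definition beast_returns (out : option (seq V) * \bar R) : Prop :=
  run init out.

End Beast.

Arguments beast_returns {R} P u_prune out.

(* Main.v *)
(* The tentative value of an edge that BEAST does not refine completely cannot
   improve a label, because the bounds of an estimator satisfy l <= u and every
   lower bound is at most the tightest upper bound.  Hence BEAST behaves as
   Dijkstra's algorithm run with the weights u_edge, restricted to labels that
   are at most u_prune, and the usual invariant applies: closed labels are at
   most the open ones, and the edges out of closed nodes are relaxed. *)
From mathcomp Require Import all_boot all_order all_algebra.
From mathcomp Require Import reals constructive_ereal.
Require Import Defs.

Set Implicit Arguments.
Unset Strict Implicit.
Unset Printing Implicit Defensive.

Import Order.TTheory GRing.Theory Num.Theory.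

Local Open Scope ring_scope.

(** * Tightest upper bounds of edges and paths *)

Section UpperBounds.
Variables (R : realType) (G : ewdg R).
Implicit Types (v w : node G) (p : seq (node G)).

Lemma mem_last_theta v w : edge v w -> last (0, 0) (theta v w) \in theta v w.
Proof. by move/theta_neq0; case: (theta v w) => //= b s _; exact: mem_last. Qed.

Lemma cost_le_u_edge v w : edge v w -> cost v w <= u_edge v w.
Proof. by move=> e; have [] := theta_bounds e (mem_last_theta e). Qed.

Lemma u_edge_ge0 v w : edge v w -> 0 <= u_edge v w.
Proof. by move=> e; apply: le_trans (cost_ge0 e) (cost_le_u_edge e). Qed.

Lemma u_path_nil v : u_path v [::] = 0.
Proof. by rewrite /u_path big_nil. Qed.

Lemma u_path_cons v w p : u_path v (w :: p) = u_edge v w + u_path w p.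
Proof. by rewrite /u_path /= big_cons. Qed.

Lemma u_path_rcons v p w :
  u_path v (rcons p w) = u_path v p + u_edge (last v p) w.
Proof.
elim: p v => [|x p IHp] v /=; first by rewrite u_path_cons !u_path_nil addrC.
by rewrite !u_path_cons IHp addrA.
Qed.

Lemma u_path_ge0 v p : path (@edge R G) v p -> 0 <= u_path v p.
Proof.
elim: p v => [|w p IHp] v /=; first by rewrite u_path_nil.
by case/andP=> e /IHp p_ge0; rewrite u_path_cons addr_ge0 ?u_edge_ge0.
Qed.

End UpperBounds.

Section Correctness.
Variables (R : realType) (P : problem R) (u_prune : \bar R).
Local Notation V := (node P).
Implicit Types (st : state P) (n m s v : V) (p : seq V).

Local Open Scope ereal_scope.

(** * Relaxation of an edge in terms of its tightest upper bound *)

Definition known st : seq V := opn st ++ closed st.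

(** This is the value [gs] that [relax] reads; it hides whatever [gu] stores at nodes not yet
    reached. *)
Definition label st v : \bar R := if v \in known st then gu st v else +oo.

Lemma refineP (gn gs : \bar R) (b : R * R) (ths : seq (R * R)) :
  refine u_prune gn gs b ths = last b ths \/
  refine u_prune gn gs b ths \in b :: ths /\
  ~~ ((gn + (refine u_prune gn gs b ths).1%:E < gs) &&
      (gn + (refine u_prune gn gs b ths).1%:E <= u_prune)).
Proof.
elim: ths b => [|b' ths IHths] b /=; first by left.
case: ifPn => [_|stop]; last by right; rewrite inE eqxx.
by case: (IHths b') => [->|[rin rstop]]; [left | right; rewrite inE rin orbT].
Qed.

(** When refinement stops early, at [b], the tests with [b.2] and with [u_edge n s] both fail, so
    both sides take the branch without update. *)
Lemma relaxE n st s : edge n s ->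
  relax u_prune n st s =
  let gt := gu st n + (u_edge n s)%:E in
  if (gt < label st s) && (gt <= u_prune)
  then State [eta gu st with s |-> gt] (s :: rem s (opn st)) (closed st)
         [eta parent st with s |-> Some n]
  else State [eta gu st with s |-> label st s] (opn st) (closed st) (parent st).
Proof.
move=> e; rewrite /relax -/(known st) -/(label st s) /=.
set b := refine _ _ _ _ _.
have stopped u : (b.1 <= u)%R ->
    ~~ ((gu st n + b.1%:E < label st s) && (gu st n + b.1%:E <= u_prune)) ->
    (gu st n + u%:E < label st s) && (gu st n + u%:E <= u_prune) = false.
  move=> le_bu; apply: contraNF => /andP[lt_u le_u].
  have le_gb : gu st n + b.1%:E <= gu st n + u%:E by rewrite leeD2l// lee_fin.
  by rewrite (le_lt_trans le_gb lt_u) (le_trans le_gb le_u).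
have := refineP (gu st n) (label st s) (0, 0)%R (theta n s).
rewrite -/b => -[->//|[b_in b_stop]].
have [b_12 b_1u] : (b.1 <= b.2)%R /\ (b.1 <= u_edge n s)%R.
  move: b_in; rewrite inE => /predU1P[|b_in].
    (* The initial pair [(0, 0)] is no estimator output, so [theta_bounds] does not cover it. *)
    by rewrite -/b => ->; rewrite u_edge_ge0.
  have [_ le_bc le_cb] := theta_bounds e b_in.
  by split; [apply: le_trans le_cb | apply: le_trans (cost_le_u_edge e)].
by rewrite (stopped _ b_12 b_stop) (stopped _ b_1u b_stop).
Qed.

(** * Invariants of the main loop and of an expansion *)

Definition supported st v : Prop :=
  gu st v <= u_prune /\
  exists m, [/\ parent st v = Some m, m \in closed st, edge m v &
                gu st v = gu st m + (u_edge m v)%:E].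

(** The premise is there because tentative labels above [u_prune] are discarded. *)
Definition relaxed st m v : Prop :=
  gu st m + (u_edge m v)%:E <= u_prune ->
  v \in known st /\ gu st v <= gu st m + (u_edge m v)%:E.

Record sound st : Prop := Sound {
  start_known : start P \in known st;
  gu_start : gu st (start P) = 0;
  gu_ge0 : {in known st, forall v, 0 <= gu st v < +oo};
  known_supported : {in known st, forall v, v != start P -> supported st v};
  closed_not_goal : {in closed st, forall m, ~~ goals m}
}.

Record loop_inv st : Prop := LoopInv {
  loop_sound : sound st;
  closed_le_opn : {in closed st & opn st, forall m v, gu st m <= gu st v};
  closed_relaxed : {in closed st, forall m v, edge m v -> relaxed st m v}
}.

Record expand_inv n (todo : seq V) st : Prop := ExpandInv {
  expand_sound : sound st;
  expanded_closed : n \in closed st;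
  closed_le_expanded : {in closed st, forall m, gu st m <= gu st n};
  expanded_le_opn : {in opn st, forall v, gu st n <= gu st v};
  done_relaxed : {in closed st, forall m v, edge m v ->
    (m == n) ==> (v \notin todo) -> relaxed st m v}
}.

Lemma mem_rem_neq (T : eqType) (x y : T) (s : seq T) :
  y != x -> (y \in rem x s) = (y \in s).
Proof. by move=> yx; apply/idP/idP => [/mem_rem//|]; exact: rem_mem. Qed.

(** The tentative label is at least [gu st n], hence at least every closed label, so a strict
    improvement never touches a closed node. Closed labels are thus final, and the equalities in
    [supported], whose parents are closed, persist. *)
Lemma relax_inv n s todo st : edge n s ->
  expand_inv n (s :: todo) st -> expand_inv n todo (relax u_prune n st s).
Proof.
move=> e [[kst g0 gge0 ksup cng] nc cle ole dr].
have ck m : m \in closed st -> m \in known st by rewrite mem_cat orbC => ->.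
have ok m : m \in opn st -> m \in known st by rewrite mem_cat => ->.
rewrite relaxE //=; set gt := gu st n + _.
have le_gt : gu st n <= gt by rewrite leeDl// lee_fin u_edge_ge0.
have /andP[n_ge0 n_fin] := gge0 _ (ck _ nc).
have gt_ge0 : 0 <= gt by exact: le_trans le_gt.
have gt_fin : gt < +oo by rewrite lte_add_pinfty ?ltry.
case: ifPn => [/andP[lt_gt le_prune]|nupd].
- have sNc : s \notin closed st.
    apply: contraL lt_gt => sc; rewrite -leNgt /label ck //.
    exact: le_trans (cle _ sc) le_gt.
  have cE m : m \in closed st -> (m == s) = false.
    by move=> mc; apply: contraNF sNc => /eqP <-.
  (* The start already has label 0, which a nonnegative [gt] cannot improve. *)
  have startE : (start P == s) = false.
    apply: contraTF lt_gt => /eqP <-.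
    by rewrite /label kst g0 -leNgt.
  have gt_le : s \in known st -> gt <= gu st s.
    by move=> sk; apply: ltW; move: lt_gt; rewrite /label sk.
  set st' := State _ _ _ _.
  have guE v : gu st' v = if v == s then gt else gu st v by [].
  have kn v : v \in known st' = (v == s) || (v \in known st).
    rewrite !mem_cat inE; have [//|vs] := eqVneq v s.
    by rewrite mem_rem_neq.
  have gu_le v : v \in known st -> gu st' v <= gu st v.
    by rewrite guE; case: eqP => // ->.
  split=> //; first split=> //.
  + by rewrite kn kst orbT.
  + by rewrite guE startE.
  + by move=> v; rewrite kn guE; case: eqP => [_ _|_ /gge0//]; rewrite gt_ge0.
  + move=> v; rewrite kn /supported guE /=; case: eqP => [->|_] /=.
      by move=> _ _; split=> //; exists n; rewrite cE.
    move=> vk /(ksup _ vk)[le_v [m [pm mc em gE]]]; split=> //.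
    by exists m; rewrite cE.
  + by move=> m mc; rewrite !guE !cE //; exact: cle.
  + move=> v; rewrite !guE (cE n) //= inE.
    by case: eqVneq => //= vs; rewrite mem_rem_neq //; exact: ole.
  + move=> m mc v emv todoP; rewrite /relaxed guE cE // => le_mv.
    (* Away from [s] labels are unchanged. At [s], the edge from [n] is tight, and for any other
       closed [m] the old bound survives because the label of [s] only decreased. *)
    have [vs|vs] := eqVneq v s; last first.
      have [|vk le_v] := dr m mc v emv _ le_mv.
        by apply/implyP => mn; rewrite inE negb_or vs (implyP todoP).
      by rewrite kn vk orbT; split=> //; apply: le_trans le_v; exact: gu_le.
    subst v; rewrite kn eqxx guE eqxx; split=> //.
    have [-> //|mn] := eqVneq m n.
    have [|sk le_s] := dr m mc s emv _ le_mv; first by rewrite (negPf mn).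
    exact: le_trans (gt_le sk) le_s.
- set st' := State _ _ _ _.
  (* Without an update, the write at [s] can alter [gu] only if [s] was unknown. *)
  have guE v : v \in known st -> gu st' v = gu st v.
    by move=> vk /=; case: eqP => // vs; rewrite /label -vs vk.
  split=> //; first split=> //.
  + by rewrite guE.
  + by move=> v vk; rewrite guE // gge0.
  + move=> v vk /(ksup _ vk)[le_v [m [pm mc em gE]]]; rewrite /supported.
    by rewrite guE //; split=> //; exists m; split=> //; rewrite guE ?ck.
  + by move=> m mc; rewrite !guE ?ck //; exact: cle.
  + by move=> v vo; rewrite (guE _ (ck _ nc)) (guE _ (ok _ vo)); exact: ole.
  + move=> m mc v emv todoP; rewrite /relaxed (guE _ (ck _ mc)) => le_mv.
    have [/andP[/eqP mn /eqP vs]|mnvs] := boolP ((m == n) && (v == s)).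
      subst m v; move: nupd; rewrite le_mv andbT -leNgt /label.
      case: ifP => [sk le_s|_]; first by rewrite guE.
      (* An unknown [s] has label [+oo], and the finite [gt] would have passed the strict test. *)
      by rewrite leNgt gt_fin.
    have [|vk le_v] := dr m mc v emv _ le_mv; last by rewrite guE.
    apply/implyP => mn; rewrite inE negb_or (implyP todoP) // andbT.
    by move: mnvs; rewrite mn.
Qed.

Lemma foldl_relax_inv n todo st : {in todo, forall s, edge n s} ->
  expand_inv n todo st -> expand_inv n [::] (foldl (relax u_prune n) st todo).
Proof.
elim: todo st => [//|s todo IHtodo] st e inv /=; apply: IHtodo => [v vt|].
  by apply: e; rewrite inE vt orbT.
by apply: relax_inv inv; apply: e; rewrite mem_head.
Qed.

Lemma expand_loop_inv n ss st : min_open st n -> ~~ goals n ->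
  (forall s, (s \in ss) = edge n s) ->
  loop_inv st -> loop_inv (expand u_prune n ss st).
Proof.
move=> [no nmin] ng ssE [[kst g0 gge0 ksup cng] clo cr].
have: expand_inv n [::] (expand u_prune n ss st).
  apply: foldl_relax_inv => [s|]; first by rewrite ssE.
  set st' := State _ _ _ _.
  have kn : known st' =i known st.
    move=> v; rewrite !mem_cat inE /=; have [->|vn] := eqVneq v n.
      by rewrite no orbT.
    by rewrite mem_rem_neq.
  have cE m : m \in closed st' = (m == n) || (m \in closed st) by rewrite inE.
  split; first split=> //.
  - by rewrite kn.
  - by move=> v; rewrite kn; exact: gge0.
  - move=> v; rewrite kn => vk /(ksup _ vk)[le_v [m [pm mc em gE]]].
    by split=> //; exists m; rewrite cE mc orbT.
  - by move=> m; rewrite cE => /predU1P[->//|]; exact: cng.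
  - exact: mem_head.
  - by move=> m; rewrite cE => /predU1P[->//|mc]; exact: clo.
  - by move=> v /mem_rem; exact: nmin.
  - move=> m; rewrite cE => mc v emv todoP le_mv.
    have mn : m != n.
      by apply: contraTN todoP => /eqP mn; rewrite mn eqxx ssE -mn emv.
    rewrite kn; apply: cr => //.
    by move: mc; rewrite (negPf mn).
by case=> snd nc cle ole dr; split=> // [m v mc vo|m mc v emv];
  [apply: le_trans (cle _ mc) (ole _ vo) | apply: dr => //; rewrite implybT].
Qed.

Lemma init_loop_inv : loop_inv (init P).
Proof.
have kn v : v \in known (init P) = (v == start P) by rewrite mem_cat inE orbF.
split=> //; split=> //=; first by rewrite kn.
- by rewrite eqxx.
- by move=> v; rewrite kn => ->; rewrite lexx ltry.
- by move=> v; rewrite kn => ->.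
Qed.

(** * Labels along paths, and correctness of the output *)

Lemma tracebackP st v p : sound st -> v \in known st -> traceback st v p ->
  [/\ path (@edge R P) (start P) p, last (start P) p = v &
      gu st v = (u_sol P p)%:E].
Proof.
move=> [kst g0 gge0 ksup cng] vk tb; elim: tb vk => {v p} [|v m p vs pm tb IH] vk.
  by rewrite /u_sol u_path_nil.
(* The parent is closed, hence known, so the induction continues; the label equalities telescope
   down to 0 at the start. *)
have [_ [m' [pm' mc em gE]]] := ksup _ vk vs.
move: pm'; rewrite pm => -[?]; subst m'.
have [|pp pl pu] := IH; first by rewrite mem_cat mc orbT.
split; first by rewrite rcons_path pp pl.
  by rewrite last_rcons.
by rewrite /u_sol u_path_rcons EFinD gE pu pl.
Qed.

(** Follow the path through closed nodes: it must leave them, since no goal is closed. Nonnegative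
    weights keep every prefix within [u_prune], so each edge followed is relaxed and the label bound
    propagates. *)
Lemma open_on_path st v p : loop_inv st -> v \in known st ->
  path (@edge R P) v p -> goals (last v p) ->
  gu st v + (u_path v p)%:E <= u_prune ->
  exists2 o, o \in opn st & gu st o <= gu st v + (u_path v p)%:E.
Proof.
move=> [[_ _ _ _ cng] _ cr].
elim: p v => [|w p IHp] v vk vp gp le_prune.
  exists v; last by rewrite leeDl// lee_fin u_path_ge0.
  by move: vk; rewrite mem_cat => /orP[//|/cng]; rewrite /= in gp; rewrite gp.
have [vo|vNo] := boolP (v \in opn st).
  by exists v => //; rewrite leeDl// lee_fin u_path_ge0.
have {vk vNo} vc : v \in closed st by move: vk; rewrite mem_cat (negPf vNo).
have /andP[evw wp] := vp.
move: le_prune; rewrite u_path_cons EFinD addeA => le_prune.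
have [|wk le_w] := cr v vc w evw.
  by apply: le_trans le_prune; rewrite leeDl// lee_fin u_path_ge0.
have [|o oo le_o] := IHp w wk wp gp.
  by apply: le_trans le_prune; exact: leeD2r.
by exists o => //; apply: le_trans le_o _; exact: leeD2r.
Qed.

Lemma open_on_solution st p : loop_inv st -> solution P p ->
  (u_sol P p)%:E <= u_prune ->
  exists2 o, o \in opn st & gu st o <= (u_sol P p)%:E.
Proof.
move=> inv [pp gp]; have [kst g0 _ _ _] := loop_sound inv.
by have := open_on_path inv kst pp gp; rewrite g0 add0e.
Qed.

Definition correct_output (out : option (seq V) * \bar R) : Prop :=
  match out.1 with
  | None => ~ exists p, solution P p /\ (u_sol P p)%:E <= u_prune
  | Some p => [/\ solution P p, is_Ustar P (u_sol P p) & out.2 = (u_sol P p)%:E]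
  end.

Lemma run_correct st out : run u_prune st out -> loop_inv st ->
  correct_output out.
Proof.
elim=> {st out} [st o0 inv|st n p [no nmin] gn tb inv|].
- case=> p [/(open_on_solution inv)] /[apply] -[o].
  by rewrite o0.
- have snd := loop_sound inv.
  have nk : n \in known st by rewrite mem_cat no.
  have [pp pl pu] := tracebackP snd nk tb.
  have sol : solution P p by split=> //; rewrite pl.
  split=> //; split=> [|q solq]; first by exists p.
  rewrite -lee_fin -pu.
  (* A competitor within [u_prune] has an open node, against which [n] is minimal; one beyond
     [u_prune] exceeds any supported label. *)
  have [le_q|lt_q] := leP (u_sol P q)%:E u_prune.
    have [o oo le_o] := open_on_solution inv solq le_q.
    exact: le_trans (nmin _ oo) le_o.
  (* The label 0 of the start is never tested against [u_prune], which may be negative. *)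
  have [ns|ns] := eqVneq n (start P).
    rewrite ns (gu_start snd) lee_fin; apply: u_path_ge0.
    by case: solq.
  have [le_n _] := known_supported snd nk ns.
  exact: le_trans le_n (ltW lt_q).
- move=> st n ss out mn ng _ ssE _ IH inv.
  by apply: IH; exact: expand_loop_inv.
Qed.

End Correctness.

Theorem theorem4 (R : realType) (P : problem R) (u_prune : \bar R) :
  (beast_returns P u_prune (None, +oo%E) ->
     ~ exists p : seq (node P), solution P p /\ ((u_sol P p)%:E <= u_prune)%E) /\
  (forall (p : seq (node P)) (g : \bar R),
     beast_returns P u_prune (Some p, g) ->
     solution P p /\
     exists Ustar : R, is_Ustar P Ustar /\ u_sol P p = Ustar /\ g = Ustar%:E).
Proof.
split=> [ret|p g ret]; have := run_correct ret (init_loop_inv P u_prune);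
  first by [].
by case=> sol opt gE; split=> //; exists (u_sol P p).
Qed.
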